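(* Let $n=2k+1$ with $k\geq 1$, let $\mathfrak{g}=\mathfrak{sl}(n+1,\mathbb{R})$ with positive roots $\Pi^+=\{\varepsilon_i-\varepsilon_j : 1\leq i<j\leq n+1\}$ and simple roots $\alpha_i=\varepsilon_i-\varepsilon_{i+1}$, $1\le i\le n$, and let $\Theta=\{\alpha_{2i} : i=1,\dots,k\}$. For $i=1,\dots,n$ set $h(i)=i+1$ if $i$ is odd and $h(i)=i+2$ if $i$ is even, $\mathrm{Ind}_i=\{h(i),h(i)+1,\dots,n+1\}$ and $\mathrm{s}_i(j)=n+1+h(i)-j$ for $j\in \mathrm{Ind}_i$, so that $\Pi^+\smallsetminus\Theta=\{\varepsilon_i-\varepsilon_j : 1\le i\le n,\ j\in\mathrm{Ind}_i\}$. Let $\sigma$ be the permutation of $\Pi^+\smallsetminus\Theta$ given by \[ \sigma(\varepsilon_i-\varepsilon_j)=\begin{cases} \varepsilon_1-\varepsilon_{\mathrm{s}_i(j)}&\text{if } i=1,\\ \varepsilon_{i+1}-\varepsilon_{\mathrm{s}_i(j)}&\text{if } i\text{ is even},\\ \varepsilon_{i-1}-\varepsilon_{\mathrm{s}_i(j)}&\text{if } i>1\text{ is odd}. \end{cases} \] Then $\sigma$ is arrow-breaking, and therefore every $\sigma$-diagonal metric on $\mathfrak{n}_\Theta$ is Ricci-flat. Moreover, these metrics are not flat.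
   Context: $\mathfrak{n}_\Theta=\bigoplus_{\gamma\in\Pi^+\smallsetminus\Theta}\mathfrak{g}_\gamma$ is the nilradical of the parabolic subalgebra of $\mathfrak{sl}(n+1,\mathbb{R})$ determined by $\Theta$ (here the set of positive roots generated by $\Theta$ is $\Theta$ itself); explicitly, it is the Lie algebra of $(n+1)\times(n+1)$ real upper triangular matrices spanned by the elementary matrices $E_{ij}$ with $1\le i\le n$, $j\ge h(i)$, where $E_{ij}$ is the root vector $x_\gamma$ for $\gamma=\varepsilon_i-\varepsilon_j$. The basis $\{x_\gamma : \gamma\in\Pi^+\smallsetminus\Theta\}$ is a nice basis; its nice diagram is the directed graph with nodes $x_\gamma$ and labeled arrows, where $x\xrightarrow{y}z$ is an arrow with source $x$, destination $z$ and label $y$ if and only if $[x,y]$ is a nonzero multiple of $z$. A permutation $\sigma$ of $\Pi^+\smallsetminus\Theta$ is identified with the permutation $x_\gamma\mapsto x_{\sigma(\gamma)}$ of the nodes. A permutation $\sigma$ of order two of the nodes is arrow-breaking if: (1) whenever $x$ has an incoming arrow with label $y$, then $\sigma(x)$ does not have an incoming arrow with label $\sigma(y)$; (2) whenever $x$ has an outgoing arrow with label $y$, then $\sigma(x)$ does not have an outgoing arrow with label $\sigma(y)$. A metric on a Lie algebra is a nondegenerate symmetric bilinear form (any signature), identified with the corresponding left-invariant pseudo-Riemannian metric on a Lie group with that Lie algebra; Ricci-flat (resp. flat) refers to vanishing of the Ricci tensor (resp. curvature tensor) of its Levi-Civita connection. A metric on $\mathfrak{n}_\Theta$ is $\sigma$-diagonal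 if $\langle x_\gamma,x_{\sigma(\delta)}\rangle=g_\gamma\delta_{\gamma\delta}$ (Kronecker delta) for all $\gamma,\delta\in\Pi^+\smallsetminus\Theta$, with $g_\gamma$ nonzero reals satisfying $g_{\sigma(\gamma)}=g_\gamma$. *)

(* Defs.v *)
From HB Require Import structures.
From mathcomp Require Import all_boot all_order all_algebra all_fingroup.
From Stdlib Require Import Lia.
From mathcomp Require Import boolp reals ring zify.

Set Implicit Arguments.
Unset Strict Implicit.
Unset Printing Implicit Defensive.

Import GRing.Theory Num.Theory.
Local Open Scope ring_scope.

Lemma linear_lfun (F : fieldType) (U V : vectType F) (f : U -> V) :
  linear f -> exists A : 'Hom(U, V), A =1 f.
Proof.
move=> lf; pose m := GRing.isLinear.Build F U V *:%R f lf.
pose h : {linear U -> V} := HB.pack f m.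
by exists (linfun h) => x; rewrite lfunE.
Qed.

Record lieAlg (R : realType) := LieAlg {
  lie_sort :> vectType R;
  lie : {bilinear lie_sort -> lie_sort -> lie_sort};
  lie_alt : forall x, lie x x = 0;
  lie_jacobi : forall x y z, lie x (lie y z) + lie y (lie z x) + lie z (lie x y) = 0
}.
Arguments lie {R l}.

Section MetricLieAlgebra.
Variables (R : realType) (L : lieAlg R).

Record metric := Metric {
  metric_form :> {symmetric L};
  metric_nondeg : nondegenerate metric_form
}.

(* Left-invariant vector fields are identified with their value at the identity,
   so that a left-invariant connection is a bilinear map (x, y) |-> D x y. *)
Definition levi_civita (g : metric) (D : 'Hom(L, 'End(L))) : Prop :=
  (forall x y, D x y - D y x = lie x y) /\
  (forall x y z, g (D x y) z + g y (D x z) = 0).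

Lemma metricC (g : metric) x y : g x y = g y x.
Proof. by rewrite hermC expr0 mul1r. Qed.

Lemma metric_eq0 (g : metric) x : (forall y, g x y = 0) -> x = 0.
Proof.
move=> gx0; apply/eqP; rewrite -memv0 -(eqP (metric_nondeg g)).
by apply/mem_orthovP => y _; apply: gx0.
Qed.

Lemma metric_inj (g : metric) x y : (forall z, g x z = g y z) -> x = y.
Proof.
move=> gxy; apply/subr0_eq/(@metric_eq0 g) => z.
by rewrite linearBl /= gxy subrr.
Qed.

Lemma metric_riesz (g : metric) (f : L -> R^o) :
  linear f -> exists w, forall z, g w z = f z.
Proof.
move=> /linear_lfun[A Af].
have gl w : exists G : 'Hom(L, R^o), forall z, G z = g w z.
  by apply: linear_lfun => a u v; rewrite linearPr.
have [G GE] := choice gl.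
have [P PE] : exists P : 'Hom(L, 'Hom(L, R^o)), P =1 G.
  apply: linear_lfun => a u v; apply/lfunP => z.
  by rewrite add_lfunE scale_lfunE !GE linearPl.
have kP : lker P == 0%VS.
  apply/eqP/vspaceP => w; rewrite memv0; apply/idP/eqP => [|->]; last exact: mem0v.
  by rewrite memv_ker PE => /eqP w0; apply: (@metric_eq0 g) => y; rewrite -GE w0 zero_lfunE.
have PT : limg P = fullv.
  apply/eqP; rewrite eqEdim subvf /= limg_dim_eq ?(eqP kP) ?capv0 //.
  by rewrite !dimvf /= /dim /= muln1.
have : A \in limg P by rewrite PT memvf.
by case/memv_imgP => w _ Aw; exists w => z; rewrite -GE -PE -Aw Af.
Qed.

Lemma lieC (x y : L) : lie x y = - lie y x.
Proof.
have := lie_alt (x + y).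
by rewrite linearDl !linearDr /= !lie_alt add0r addr0 => /eqP; rewrite addr_eq0 => /eqP.
Qed.

Lemma levi_civita_koszul g D : levi_civita g D ->
  forall x y z, g (D x y) z *+ 2 = g (lie x y) z - g (lie y z) x + g (lie z x) y.
Proof.
move=> [tor met] x y z; rewrite -!tor !linearBl /=.
have mE a b c : g (D a b) c = - g (D a c) b.
  by apply/eqP; rewrite -addr_eq0 [g (D a c) b]metricC met.
by rewrite [g (D y z) x]mE [g (D z x) y]mE [g (D x z) y]mE; ring.
Qed.

Lemma levi_civita_unique g D1 D2 :
  levi_civita g D1 -> levi_civita g D2 -> D1 = D2.
Proof.
move=> /levi_civita_koszul k1 /levi_civita_koszul k2.
apply/lfunP => x; apply/lfunP => y; apply: (@metric_inj g) => z.
by apply/(pmulrnI (ltn0Sn 1)); rewrite k1 k2.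
Qed.

Lemma levi_civita_exists g : exists D, levi_civita g D.
Proof.
pose K x y z : R^o := 2^-1 * (g (lie x y) z - g (lie y z) x + g (lie z x) y).
have rz x y : exists w, forall z, g w z = K x y z.
  apply: metric_riesz => a u v; rewrite /K !(linearPl, linearPr) /=.
  by rewrite /GRing.scale /=; ring.
have /choice[W /= WE] : forall xy : L * L, exists w, forall z, g w z = K xy.1 xy.2 z.
  by move=> [x y]; apply: rz.
have Wr x : exists A : 'End(L), forall y, A y = W (x, y).
  apply: linear_lfun => a u v; apply: (@metric_inj g) => z.
  rewrite linearPl /= !WE /K /= !(linearPl, linearPr) /=.
  by ring.
have [A AE] := choice Wr.
have [D DE] : exists D : 'Hom(L, 'End(L)), D =1 A.
  apply: linear_lfun => a u v; apply/lfunP => y; apply: (@metric_inj g) => z.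
  rewrite add_lfunE scale_lfunE !AE linearPl /= !WE /K /=.
  rewrite !(linearPl, linearPr) /=.
  by ring.
have DW x y z : g (D x y) z = K x y z by rewrite DE AE WE.
have gN u v : g (- u) v = - g u v by rewrite linearNl.
exists D; split=> [x y|x y z].
  apply: (@metric_inj g) => z; rewrite linearBl /= !DW /K.
  rewrite [lie y x]lieC [lie x z]lieC [lie z y]lieC !gN; by field.
rewrite (metricC g y) !DW /K.
rewrite [lie x z]lieC [lie z y]lieC [lie y x]lieC !gN; by ring.
Qed.

Definition lc_connection g : 'Hom(L, 'End(L)) :=
  projT1 (cid (levi_civita_exists g)).

Lemma lc_connectionP g : levi_civita g (lc_connection g).
Proof. exact: projT2 (cid (levi_civita_exists g)). Qed.

Lemma lc_connection_eq g D : levi_civita g D -> lc_connection g = D.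
Proof. exact/levi_civita_unique/lc_connectionP. Qed.

Definition curvature (D : 'Hom(L, 'End(L))) (x y : L) : 'End(L) :=
  (D x \o D y)%VF - (D y \o D x)%VF - D (lie x y).

Definition lin_trace (f : L -> L) : R :=
  \sum_(i < \dim {:L}) coord (vbasis {:L}) i (f (vbasis {:L})`_i).

Definition ricci (D : 'Hom(L, 'End(L))) (x y : L) : R :=
  lin_trace (fun z => curvature D z x y).

Definition ricci_flat g : Prop := forall x y, ricci (lc_connection g) x y = 0.

Definition flat g : Prop := forall x y, curvature (lc_connection g) x y = 0.

Section NiceDiagram.
Variables (I : finType) (e : I -> L).

(* arrow x y z is the arrow from the node x to the node z with label y. *)
Definition arrow (x y z : I) : Prop :=
  exists2 c : R, c != 0 & lie (e x) (e y) = c *: e z.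

Definition incoming (x y : I) : Prop := exists w, arrow w y x.

Definition outgoing (x y : I) : Prop := exists z, arrow x y z.

Definition arrow_breaking (s : {perm I}) : Prop :=
  [/\ #[s]%g = 2%N,
      forall x y, incoming x y -> ~ incoming (s x) (s y)
    & forall x y, outgoing x y -> ~ outgoing (s x) (s y)].

Definition sigma_diagonal (s : {perm I}) (g : metric) : Prop :=
  exists c : I -> R,
    [/\ forall i, c i != 0,
        forall i, c (s i) = c i
      & forall i j, g (e i) (e (s j)) = c i * (i == j)%:R].

End NiceDiagram.

End MetricLieAlgebra.

Section MatrixLieAlgebra.
Variables (R : realType) (m : nat) (U : {vspace 'M[R]_m}).

Definition mx_comm (X Y : 'M[R]_m) := X *m Y - Y *m X.

Hypothesis closedU : {in U &, forall X Y, mx_comm X Y \in U}.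

Definition sub_bracket (x y : subvs_of U) : subvs_of U :=
  vsproj U (mx_comm (vsval x) (vsval y)).

Lemma sub_bracketE x y : vsval (sub_bracket x y) = mx_comm (vsval x) (vsval y).
Proof. by rewrite vsprojK ?closedU ?subvsP. Qed.

Fact sub_bracket_bilinear : bilinear_for *:%R *:%R sub_bracket.
Proof.
split=> z a u v; apply: val_inj; rewrite linearP /= !sub_bracketE linearP /mx_comm /=.
  by rewrite mulmxDl mulmxDr -scalemxAl -scalemxAr scalerBr addrACA -opprD.
by rewrite mulmxDl mulmxDr -scalemxAl -scalemxAr scalerBr addrACA -opprD.
Qed.

Definition sub_lie : {bilinear subvs_of U -> subvs_of U -> subvs_of U} :=
  HB.pack sub_bracket (bilinear_isBilinear.Build R _ _ _ _ _ _ sub_bracket_bilinear).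

Fact sub_lie_alt x : sub_lie x x = 0.
Proof. by apply: subvs_inj; rewrite /= sub_bracketE /mx_comm subrr. Qed.

Fact sub_lie_jacobi x y z :
  sub_lie x (sub_lie y z) + sub_lie y (sub_lie z x) + sub_lie z (sub_lie x y) = 0.
Proof.
apply: subvs_inj; rewrite [RHS]linear0 !linearD /= !sub_bracketE /mx_comm.
move: (vsval x) (vsval y) (vsval z) => {x y z}X Y Z.
rewrite !(mulmxBl, mulmxBr) !mulmxA.
move: (X *m Y *m Z) (X *m Z *m Y) (Y *m X *m Z) (Y *m Z *m X) (Z *m X *m Y) (Z *m Y *m X).
by move=> a b c d e f; apply/matrixP => i j; rewrite !mxE; ring.
Qed.

Definition mx_lieAlg : lieAlg R := LieAlg sub_lie_alt sub_lie_jacobi.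

End MatrixLieAlgebra.

(* The root eps_i - eps_j of sl(n+1), 1 <= i, j <= n+1, is encoded by the pair
   (i - 1, j - 1) of ordinals; [rootD n i j] takes the 1-based indices. *)
Definition root n := ('I_n.+1 * 'I_n.+1)%type.

Definition rootD n (i j : nat) : root n := (inord i.-1, inord j.-1).

Definition pos_roots n : {set root n} := [set p : root n | (p.1 < p.2)%N].

Definition simple_root n (i : nat) : root n := rootD n i i.+1.

Definition root_vector (R : realType) n (p : root n) : 'M[R]_n.+1 :=
  delta_mx p.1 p.2.

Lemma root_vector_weight (R : realType) n (d : 'rV[R]_n.+1) (p : root n) :
  mx_comm (diag_mx d) (root_vector R p) = (d 0 p.1 - d 0 p.2) *: root_vector R p.
Proof.
apply/matrixP => i j; rewrite /mx_comm mul_diag_mx mul_mx_diag !mxE.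
have [->|] := eqVneq i p.1; have [->|] := eqVneq j p.2; rewrite /= => *; ring.
Qed.

(* The rank n of sl(n+1). *)
Definition rk k := (2 * k).+1.

Definition Theta k : {set root (rk k)} :=
  [set simple_root (rk k) (2 * i) | i : 'I_k.+1 & (0 < i)%N].

Definition nilroots k : {set root (rk k)} := pos_roots (rk k) :\: Theta k.

Notation node k := {p : root (rk k) | p \in nilroots k}.

Definition n_Theta_space (R : realType) k : {vspace 'M[R]_((rk k).+1)} :=
  (\sum_(p in nilroots k) <[root_vector R p]>)%VS.

(* These take 1-based indices: hidx is h, [Ind n i j] means j \in Ind_i, and
   [sidx n i j] is s_i(j). *)
Definition hidx (i : nat) : nat := if odd i then i.+1 else i.+2.

Definition Ind n (i j : nat) : bool := (hidx i <= j <= n.+1)%N.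

Definition sidx n (i j : nat) : nat := n.+1 + hidx i - j.

Lemma rootDK n (p : root n) : rootD n p.1.+1 p.2.+1 = p.
Proof. by case: p => i j; rewrite /rootD /= !inord_val. Qed.

Lemma rootD_fst n i j : (0 < i <= n.+1)%N -> (rootD n i j).1.+1 = i.
Proof. by move=> /andP[i0 le_in]; rewrite /= inordK prednK. Qed.

Lemma rootD_snd n i j : (0 < j <= n.+1)%N -> (rootD n i j).2.+1 = j.
Proof. by move=> /andP[i0 le_in]; rewrite /= inordK prednK. Qed.

Lemma nodeE k (p : root (rk k)) :
  (p \in nilroots k) = Ind (rk k) p.1.+1 p.2.+1.
Proof.
case: p => i j; rewrite /nilroots !inE /Ind /hidx /=.
have ltj : (j < (rk k).+1)%N by apply: ltn_ord.
apply/andP/idP => [[/imsetP nT lt_ij]|ij].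
  have odd_ij : ~ (odd i /\ (i.+1 = j)%N).
    move=> [oi ij]; apply: nT; pose l := j./2.
    have jo : ~~ odd j by rewrite -ij /= oi.
    have jE : j = l.*2 :> nat by rewrite -[LHS]odd_double_half (negPf jo).
    have l0 : (0 < l)%N by rewrite -double_gt0 -jE -ij.
    have lt_l : (l < k.+1)%N by move: ltj; rewrite jE /rk; lia.
    exists (Ordinal lt_l); first by rewrite inE.
    have iE : i = l.*2.-1 :> nat by rewrite -jE -ij.
    by congr (_, _); apply: ord_inj; rewrite inordK /= mul2n -?iE -?jE.
  case: ifP => [oi|/negbFE oi]; first by lia.
  have {odd_ij} : i.+1 != j :> nat by apply/eqP => ij; case: odd_ij.
  by lia.
split; last by move: ij; case: ifP; lia.
apply/imsetP => -[l]; rewrite inE => l0 [ei ej].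
have lt_l := ltn_ord l.
move: (congr1 val ei) (congr1 val ej); rewrite /= !inordK; try by rewrite /rk; lia.
move=> iE jE; move: ij; rewrite iE jE.
have -> : odd (2 * l).-1 by rewrite -[l in (2 * l)%N]prednK // mulnS /= oddM.
by rewrite /=; lia.
Qed.

Lemma node_rootD k i j : (0 < i)%N -> Ind (rk k) i j ->
  [/\ rootD (rk k) i j \in nilroots k,
      (rootD (rk k) i j).1.+1 = i & (rootD (rk k) i j).2.+1 = j].
Proof.
rewrite /Ind => i0 ij; have lt_i : (i < hidx i)%N by rewrite /hidx; case: ifP.
have i1 : (rootD (rk k) i j).1.+1 = i by rewrite rootD_fst //; lia.
have j1 : (rootD (rk k) i j).2.+1 = j by rewrite rootD_snd //; lia.
by rewrite nodeE i1 j1.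
Qed.

Definition sigma_root k (p : root (rk k)) : root (rk k) :=
  let i := p.1.+1 in
  let j := p.2.+1 in
  if i == 1%N then rootD (rk k) 1 (sidx (rk k) i j)
  else if ~~ odd i then rootD (rk k) i.+1 (sidx (rk k) i j)
  else rootD (rk k) i.-1 (sidx (rk k) i j).

Lemma sigma_root_rootD k i j : (0 < i)%N -> Ind (rk k) i j ->
  sigma_root (rootD (rk k) i j) =
    if i == 1%N then rootD (rk k) 1 (sidx (rk k) i j)
    else if ~~ odd i then rootD (rk k) i.+1 (sidx (rk k) i j)
    else rootD (rk k) i.-1 (sidx (rk k) i j).
Proof. by move=> i0 ij; case: (node_rootD i0 ij) => _ i1 j1; rewrite /sigma_root i1 j1. Qed.

Lemma sigma_rootP k (p : root (rk k)) :
  p \in nilroots k -> sigma_root p \in nilroots k /\ sigma_root (sigma_root p) = p.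
Proof.
rewrite nodeE -[in sigma_root p](rootDK p) -[in RHS](rootDK p).
move: p.1.+1 (ltn0Sn p.1) p.2.+1 => i i0 j ij; rewrite (sigma_root_rootD i0 ij).
have [i' [i'0 hi' i'K ->]] : exists i' : nat,
    [/\ (0 < i')%N, hidx i' = hidx i,
        (if i' == 1%N then 1%N else if ~~ odd i' then i'.+1 else i'.-1) = i &
        (if i == 1%N then rootD (rk k) 1 (sidx (rk k) i j)
         else if ~~ odd i then rootD (rk k) i.+1 (sidx (rk k) i j)
         else rootD (rk k) i.-1 (sidx (rk k) i j)) = rootD (rk k) i' (sidx (rk k) i j)].
  have [->|i1] := eqVneq i 1%N; first by exists 1%N.
  case: i i0 i1 {ij} => [//|i] _ i1.
  have [oi|oi] := boolP (odd i.+1).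
    exists i; rewrite /hidx oi /=; move: oi => /= oi; rewrite (negPf oi) /=.
    by split=> //; [lia | case: eqP oi => // ->].
  by exists i.+2; rewrite /hidx /=; move: oi => /= /negbNE ->.
have ij' : Ind (rk k) i' (sidx (rk k) i j).
  by move: ij; rewrite /Ind /sidx hi'; lia.
case: (node_rootD i'0 ij') => nd _ _; split=> //.
have jK : sidx (rk k) i' (sidx (rk k) i j) = j.
  by move: ij; rewrite /Ind /sidx hi'; lia.
rewrite (sigma_root_rootD i'0 ij') jK -i'K.
by case: eqP => // _; case: ifP.
Qed.

Lemma sigma_root_node k (p : root (rk k)) :
  p \in nilroots k ->
  sigma_root p \in nilroots k.
Proof. by case/sigma_rootP. Qed.

Definition sigma_fun k (p : node k) : node k :=
  exist _ (sigma_root (val p)) (sigma_root_node (valP p)).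

Lemma sigma_funK k : involutive (@sigma_fun k).
Proof. by move=> p; apply: val_inj; case: (sigma_rootP (valP p)). Qed.

Definition sigma k : {perm node k} := perm (inv_inj (@sigma_funK k)).

Lemma sigmaE k (p : node k) : val (sigma k p) = sigma_root (val p).
Proof. by rewrite permE. Qed.

Lemma mul_root_vector (R : realType) k (p q : root (rk k)) :
  p \in nilroots k -> q \in nilroots k ->
  root_vector R p *m root_vector R q \in n_Theta_space R k.
Proof.
rewrite !nodeE /Ind => hp hq; rewrite /root_vector.
have [e|ne] := eqVneq p.2 q.1; last by rewrite mul_delta_mx_0 ?mem0v.
rewrite e mul_delta_mx.
have pq : (p.1, q.2) \in nilroots k.
  have lt_h i : (i < hidx i)%N by rewrite /hidx; case: ifP.
  rewrite nodeE /Ind /=; move: hp hq (lt_h q.1.+1) (lt_h p.1.+1); rewrite e; lia.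
by rewrite (subvP (sumv_sup _ pq (subvv _))) // memv_line.
Qed.

Lemma n_Theta_closed (R : realType) k :
  {in n_Theta_space R k &, forall X Y, mx_comm X Y \in n_Theta_space R k}.
Proof.
suff mulc : {in n_Theta_space R k &, forall X Y, X *m Y \in n_Theta_space R k}.
  by move=> X Y nX nY; rewrite /mx_comm rpredB ?mulc.
move=> X Y /memv_sumP[a aP ->] /memv_sumP[b bP ->].
rewrite mulmx_suml rpred_sum // => p np; rewrite mulmx_sumr rpred_sum // => q nq.
have /vlineP[c ->] := aP _ np; have /vlineP[d ->] := bP _ nq.
by rewrite -scalemxAl -scalemxAr !rpredZ ?mul_root_vector.
Qed.

Definition n_Theta (R : realType) k : lieAlg R := mx_lieAlg (@n_Theta_closed R k).

Lemma root_vector_n_Theta (R : realType) k (p : node k) :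
  root_vector R (val p) \in n_Theta_space R k.
Proof.
by rewrite (subvP (sumv_sup _ (valP p) (subvv _))) // memv_line.
Qed.

Definition xvec (R : realType) k (p : node k) : n_Theta R k :=
  Subvs (root_vector_n_Theta R p).
Arguments xvec : clear implicits.

Lemma lie_n_Theta (R : realType) k (x y : n_Theta R k) :
  vsval (lie x y) = vsval x *m vsval y - vsval y *m vsval x.
Proof. exact: (sub_bracketE (@n_Theta_closed R k)). Qed.

Lemma xvec_basis (R : realType) k : basis_of {:n_Theta R k} (codom (xvec R k)).
Proof.
rewrite /basis_of eqEsubv subvf /=; apply/andP; split.
  apply/subvP => x _; have := subvsP x; case/memv_sumP => a aP xE.
  have -> : x = \sum_(p : node k) (a (val p) (val p).1 (val p).2) *: xvec R k p.
    apply: subvs_inj; rewrite linear_sum xE /= big_sub /=.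
    apply: eq_bigr => p _; have /vlineP[c ->] := aP _ (valP p).
    by rewrite /root_vector !mxE !eqxx mulr1.
  by apply: rpred_sum => p _; rewrite rpredZ ?memv_span ?codom_f.
apply/(freeP (X := codom_tuple (xvec R k))) => c c0 i.
have /matrixP/(_ (val (enum_val i)).1 (val (enum_val i)).2) := congr1 vsval c0.
rewrite linear_sum summxE (bigD1 i) //= big1 => [|j ji].
  by rewrite nth_codom /root_vector /= !mxE !eqxx addr0 mulr1.
rewrite nth_codom /root_vector /= !mxE -xpair_eqE -!surjective_pairing.
by rewrite (inj_eq val_inj) (inj_eq enum_val_inj) eq_sym (negPf ji) mulr0.
Qed.

(* Main.v *)
(**
Let [D] be the Levi-Civita connection and put [P y z = D z y]. Since the Lie
algebra is nilpotent, hence unimodular, [ric x y = - tr (P x \o P y)]. The Koszul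
formula reads [- 2 P y = S y + A y], where [S y], the sum of [ad y] and its
adjoint [ad' y], is self-adjoint and [A y], given by
[g (A y z) w = g y (lie z w)], is skew. As [tr (ad x \o ad y) = 0], it follows
that [4 tr (P x \o P y) = 2 tr (ad x \o ad' y) + tr (A x \o A y)]. Written in a
nice basis with a sigma-diagonal metric, each single term of the first trace is
ruled out by condition (1) of arrow-breaking, and each term of the second by
condition (2).

That sigma breaks outgoing arrows is a parity phenomenon: sigma preserves the
parity of the column of a root and reverses that of its row, unless the row is 1.

With [N = n + 1], [u = E_(1,2)], [y = E_(N-1,N)] and [w = E_(3,N)], the metric is
not flat since [g (R(u, y) u) w <> 0]: here [D y u] is a nonzero multiple of
[E_(1,3)], [D u u] is a multiple of [E_(3,4)], [g (D u E_(1,3)) w <> 0] and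
[g (D y E_(3,4)) w = 0].
*)

From HB Require Import structures.
Require Import Defs.
From mathcomp Require Import all_boot all_order all_algebra all_fingroup.
From mathcomp Require Import cyclic boolp reals.
From Stdlib Require Import Lia.
From mathcomp Require Import ring zify.

Set Implicit Arguments.
Unset Strict Implicit.
Unset Printing Implicit Defensive.

Import GRing.Theory Num.Theory.
Local Open Scope ring_scope.

(** * Traces and the Ricci tensor of a sigma-diagonal metric *)

Lemma lin_trace_resolution (R : realType) (L : lieAlg R) (I : finType)
    (e : I -> L) (phi : I -> L -> R) (f : L -> L) :
  (forall i, linear (phi i : L -> R^o)) -> linear f ->
  (forall x, x = \sum_i phi i x *: e i) ->
  lin_trace f = \sum_i phi i (f (e i)).
Proof.
move=> phil fl res.
pose f' : {linear L -> L} := HB.pack f (GRing.isLinear.Build R L L *:%R f fl).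
pose phi' i : {linear L -> R^o} :=
  HB.pack (phi i : L -> R^o) (GRing.isLinear.Build R L R^o *:%R _ (phil i)).
rewrite /lin_trace.
(* Only the argument of [f] is resolved along [e]; after exchanging the sums, the coordinates in
   [vbasis] reassemble [f (e p)] inside [phi p]. *)
transitivity (\sum_(i < \dim {:L}) \sum_p
    phi p (vbasis {:L})`_i * coord (vbasis {:L}) i (f (e p))).
  apply: eq_bigr => i _; rewrite {1}[_`_i]res.
  rewrite -[f _]/(f' _) !linear_sum /=; apply: eq_bigr => p _.
  by rewrite -[f _]/(f' _) !linearZ.
rewrite exchange_big; apply: eq_bigr => p _ /=.
rewrite [f (e p) in RHS](coord_vbasis (memvf _)).
rewrite -[phi p _]/(phi' p _) linear_sum; apply: eq_bigr => i _ /=.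
by rewrite -[phi p (_ *: _)]/(phi' p _) linearZ_LR /= /GRing.scale /= mulrC.
Qed.

Lemma double_eq0 (R : realType) (x : R) : x + x = 0 -> x = 0.
Proof. by move=> /eqP; rewrite -mulr2n mulrn_eq0 => /eqP. Qed.

Section SigmaDiagonal.
Variables (R : realType) (L : lieAlg R) (I : finType) (e : I -> L).
Variables (s : {perm I}) (g : metric L) (c : I -> R).
Hypothesis e_span : <<codom e>>%VS = fullv.
Hypothesis sK : involutive s.
Hypothesis c_neq0 : forall i, c i != 0.
Hypothesis gE : forall i j, g (e i) (e (s j)) = c i * (i == j)%:R.
Hypothesis cs : forall i, c (s i) = c i.


(** The vectors [e (s j)], divided by [c j], form the basis dual to [e] under [g]. *)
Lemma sigma_diagonal_expand v : v = \sum_j (g v (e (s j)) / c j) *: e j.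
Proof.
have : v \in <<codom_tuple e>>%VS by rewrite e_span memvf.
move=> /coord_span vE.
have {vE} [a vE] : exists a : I -> R, v = \sum_j a j *: e j.
  exists (fun j => coord (codom_tuple e) (enum_rank j) v).
  rewrite {1}vE (reindex enum_rank) /=; last by apply: onW_bij; apply: enum_rank_bij.
  by apply: eq_bigr => j _; rewrite nth_codom enum_rankK.
rewrite {1}vE; apply: eq_bigr => j _; congr (_ *: _).
rewrite vE linear_sumlz (bigD1 j) //= big1 => [|i ij].
  by rewrite linearZl_LR /= gE eqxx mulr1 addr0 mulfK.
by rewrite linearZl_LR /= gE (negPf ij) !mulr0.
Qed.

Lemma sigma_diagonal_line v r :
  (forall i, i != r -> g v (e (s i)) = 0) -> v = (g v (e (s r)) / c r) *: e r.
Proof.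
move=> vr; rewrite {1}[v]sigma_diagonal_expand (bigD1 r) //= big1 ?addr0 // => i /vr ->.
by rewrite mul0r scale0r.
Qed.

Lemma sigma_diagonal_trace (f : L -> L) :
  linear f -> lin_trace f = \sum_i g (f (e i)) (e (s i)) / c i.
Proof.
move=> fl; pose phi i x := g x (e (s i)) / c i.
rewrite (lin_trace_resolution (e := e) (phi := phi) _ fl) //.
  by move=> i a x y; rewrite /phi linearPl /= mulrDl /GRing.scale /= mulrA.
exact: sigma_diagonal_expand.
Qed.

(* If [a] and [b] are the matrices [g (f (e i)) (e j)] of two endomorphisms,
   this is the trace of their product. *)
Definition pairing (a b : I -> I -> R) : R :=
  \sum_i \sum_j a i (s j) * b j (s i) / (c i * c j).

Lemma pairingC a b : pairing a b = pairing b a.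
Proof.
rewrite /pairing exchange_big; apply: eq_bigr => i _; apply: eq_bigr => j _.
by rewrite [c i * _]mulrC [a j _ * _]mulrC.
Qed.

(** Transposing the matrix of a form means taking the [g]-adjoint, and a trace of a product is
    unchanged when both factors are replaced by their adjoints. *)
Lemma pairing_tr a b : pairing (fun i j => a j i) (fun i j => b j i) = pairing a b.
Proof.
rewrite /pairing (reindex_inj (@perm_inj _ s)) exchange_big /=.
rewrite (reindex_inj (@perm_inj _ s)) /=.
apply: eq_bigr => i _; apply: eq_bigr => j _.
by rewrite !sK !cs [c i * _]mulrC.
Qed.

Lemma pairing_sym_alt a b :
  (forall i j, a i j = a j i) -> (forall i j, b i j = - b j i) -> pairing a b = 0.
Proof.
move=> aS bA; apply: double_eq0; rewrite -{1}pairing_tr.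
rewrite -big_split /= big1 // => i _; rewrite -big_split /= big1 // => j _.
by rewrite [a (s j) i]aS [b (s i) j]bA mulrN mulNr addNr.
Qed.

Lemma pairingD a b a' b' :
  pairing (fun i j => a i j + b i j) (fun i j => a' i j + b' i j) =
  pairing a a' + pairing a b' + pairing b a' + pairing b b'.
Proof.
rewrite /pairing -!big_split /=; apply: eq_bigr => i _.
by rewrite -!big_split /=; apply: eq_bigr => j _; ring.
Qed.

Variable D : 'Hom(L, 'End(L)).
Hypothesis D_lc : levi_civita g D.

(** In this order, the matrices of the endomorphisms [P y], [ad y] and [A y] of the overview. *)
Let kos (y : L) i j : R := g (D (e i) y) (e j).
Let ad_form (y : L) i j : R := g (lie y (e i)) (e j).
Let bracket_form (y : L) i j : R := g (lie (e i) (e j)) y.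

Lemma bracket_form_alt y i j : bracket_form y i j = - bracket_form y j i.
Proof. by rewrite /bracket_form [lie (e i) _]lieC linearNl. Qed.

Lemma koszul_split y i j :
  kos y i j *+ 2 = - ((ad_form y i j + ad_form y j i) + bracket_form y i j).
Proof.
rewrite /kos (levi_civita_koszul D_lc) /ad_form /bracket_form.
by rewrite [lie (e i) y]lieC [lie (e i) (e j)]lieC !linearNl /=; ring.
Qed.

(** The sum is the trace of [P w]. It equals - tr (ad w), because [ad w] and its adjoint have the
    same trace and the skew part [A w] is traceless. *)
Lemma sum_koszul_diag w : lin_trace (lie w) = 0 -> \sum_i kos w i (s i) / c i = 0.
Proof.
rewrite sigma_diagonal_trace; last by move=> a u v; rewrite linearPr.
rewrite -/(ad_form _ _ _) => tr0.
have tr0' : \sum_i ad_form w (s i) i / c i = 0.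
  rewrite -[RHS]tr0 (reindex_inj (@perm_inj _ s)) /=.
  by apply: eq_bigr => i _; rewrite sK cs.
have alt0 : \sum_i bracket_form w i (s i) / c i = 0.
  apply: double_eq0; rewrite {1}(reindex_inj (@perm_inj _ s)) /=.
  rewrite -big_split /= big1 // => i _.
  by rewrite sK cs bracket_form_alt mulNr addNr.
apply: double_eq0; rewrite -mulr2n -sumrMnl.
transitivity (- (\sum_i ad_form w i (s i) / c i + \sum_i ad_form w (s i) i / c i
                 + \sum_i bracket_form w i (s i) / c i)).
  rewrite -!big_split -sumrN /=; apply: eq_bigr => i _.
  by rewrite -mulrnAl koszul_split mulNr !mulrDl.
by rewrite alt0 tr0' [X in X + _ + _]tr0 !addr0 oppr0.
Qed.

(** Since [D] is torsion-free, [D x (D z y)] splits into [D (D z y) x] and a bracket. The trace of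
    the first term of [curvE] is tr P (D x y) = 0 by unimodularity, the second gives the pairing,
    and the last two cancel, being traces of [ad x] and [P y] composed in either order. *)
Lemma ricci_pairing x y :
  (forall w : L, lin_trace (lie w) = 0) ->
  ricci D x y = - pairing (kos y) (kos x).
Proof.
move=> unimod; have [torD _] := D_lc.
have curvE z : curvature D z x y =
    D z (D x y) - D (D z y) x - lie x (D z y) + D (lie x z) y.
  rewrite /curvature !add_lfunE !opp_lfunE !comp_lfunE.
  rewrite [lie z x]lieC linearN opp_lfunE opprK -!addrA; congr (_ + _).
  by rewrite addrA -opprD -[lie x (D z y)]torD [D _ x + _]addrC subrK.
rewrite /ricci sigma_diagonal_trace; last first.
  have DP a u v w : D (a *: u + v) w = a *: D u w + D v w.
    by rewrite linearP add_lfunE scale_lfunE.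
  move=> a u v; rewrite !curvE linearPr /= !DP !linearPr /=.
  apply: (@metric_inj _ _ g) => z; rewrite !(linearDl, linearNl, linearZl_LR) /=.
  by ring.
have expandD v w : D v w = \sum_j (g v (e (s j)) / c j) *: D (e j) w.
  rewrite {1}[v]sigma_diagonal_expand linear_sum sum_lfunE.
  by apply: eq_bigr => j _; rewrite linearZ scale_lfunE.
have term2 : \sum_i g (D (D (e i) y) x) (e (s i)) / c i = pairing (kos y) (kos x).
  apply: eq_bigr => i _; rewrite expandD linear_sumlz /= mulr_suml.
  apply: eq_bigr => j _; rewrite linearZl_LR /= /kos.
  by rewrite invfM; ring.
have term3 : \sum_i g (lie x (D (e i) y)) (e (s i)) / c i =
             pairing (kos y) (ad_form x).
  apply: eq_bigr => i _; rewrite {1}[D (e i) y]sigma_diagonal_expand.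
  rewrite linear_sumr linear_sumlz /= mulr_suml.
  apply: eq_bigr => j _; rewrite linearZr_LR linearZl_LR /= /kos /ad_form.
  by rewrite invfM; ring.
have term4 : \sum_i g (D (lie x (e i)) y) (e (s i)) / c i =
             pairing (ad_form x) (kos y).
  apply: eq_bigr => i _; rewrite expandD linear_sumlz /= mulr_suml.
  apply: eq_bigr => j _; rewrite linearZl_LR /= /kos /ad_form.
  by rewrite invfM; ring.
under eq_bigr do rewrite curvE linearDl !linearBl /= !(mulrDl, mulNr).
rewrite !big_split !sumrN /= term2 term3 term4 [pairing (ad_form x) _]pairingC.
have := sum_koszul_diag (unimod (D x y)); rewrite {1}/kos => ->.
by rewrite sub0r subrK.
Qed.

Lemma pairing_koszul x y :
  pairing (kos y) (kos x) *+ 4 =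
    pairing (fun i j => ad_form y i j + ad_form y j i)
            (fun i j => ad_form x i j + ad_form x j i)
    + pairing (bracket_form y) (bracket_form x).
Proof.
have kosE z : kos z = fun i j => - (2^-1 *
    ((ad_form z i j + ad_form z j i) + bracket_form z i j)).
  apply/funext => i; apply/funext => j.
  by rewrite -mulrN -koszul_split; field.
transitivity (pairing
    (fun i j => (ad_form y i j + ad_form y j i) + bracket_form y i j)
    (fun i j => (ad_form x i j + ad_form x j i) + bracket_form x i j)).
  rewrite !kosE /pairing -sumrMnl; apply: eq_bigr => i _.
  rewrite -sumrMnl; apply: eq_bigr => j _.
  by field; rewrite !c_neq0.
have cross u v : pairing (fun i j => ad_form u i j + ad_form u j i) (bracket_form v) = 0.
  by apply: pairing_sym_alt => i j; [apply: addrC | apply: bracket_form_alt].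
by rewrite pairingD cross [pairing (bracket_form y) (fun _ _ => _)]pairingC cross !addr0.
Qed.

End SigmaDiagonal.

(** The height [ht] expresses nilpotency: every [ad w] strictly raises it, which gives both
    unimodularity and the vanishing of tr (ad u \o ad v). *)
Theorem ricci_flat_arrow_breaking (R : realType) (L : lieAlg R) (I : finType)
    (e : I -> L) (s : {perm I}) (g : metric L) (ht : I -> nat) :
  <<codom e>>%VS = fullv ->
  (forall i j, lie (e i) (e j) = 0 \/ exists k, arrow e i j k) ->
  (forall i j k, arrow e i j k -> (ht j < ht k)%N) ->
  arrow_breaking e s -> sigma_diagonal e s g -> ricci_flat g.
Proof.
move=> e_span nice ht_arrow [s2 s_in s_out] [c [c0 cs gE]] x y.
have sK : involutive s.
  by move=> i; rewrite -permM -[(s * s)%g]/(s ^+ 2)%g -s2 expg_order perm1.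
have D_lc := lc_connectionP g.
have ad_arrow w i j : g (lie w (e i)) (e (s j)) != 0 -> exists a, arrow e a i j.
  move=> nz; apply: contrapT => noarrow; case/eqP: nz.
  rewrite [w](sigma_diagonal_expand e_span c0 gE) !linear_sumlz /= big1 // => a _.
  rewrite !linearZl_LR /=; have [->|[k ak]] := nice a i; first by rewrite linear0l mulr0.
  case: (ak) => d _ ->; rewrite linearZl_LR /= gE.
  by have [kE|_] := eqVneq k j; [case: noarrow; exists a; rewrite -kE | rewrite !mulr0].
have br_arrow z i j : g (lie (e i) (e j)) z != 0 -> outgoing e i j.
  by have [->|] := nice i j; [rewrite linear0l eqxx|].
have unimod (w : L) : lin_trace (lie w) = 0.
  rewrite (sigma_diagonal_trace e_span c0 gE); last by move=> a u v; rewrite linearPr.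
  rewrite big1 // => i _; apply/eqP; rewrite mulf_eq0; apply/orP; left.
  by apply/negPn/negP => /ad_arrow[a] /ht_arrow; rewrite ltnn.
have ad_nil u v i j : g (lie u (e i)) (e (s j)) * g (lie v (e j)) (e (s i)) = 0.
  apply/eqP/negPn/negP; rewrite mulf_eq0 negb_or => /andP[/ad_arrow[a] + /ad_arrow[b]].
  by move=> /ht_arrow ij /ht_arrow /(ltn_trans ij); rewrite ltnn.
have ad_break u v i j : g (lie u (e i)) (e (s j)) * g (lie v (e (s i))) (e (s (s j))) = 0.
  apply/eqP/negPn/negP; rewrite mulf_eq0 negb_or => /andP[/ad_arrow[a] + /ad_arrow[b]].
  by move=> ai bi; case: (s_in j i); [exists a | exists b].
have br_break u v i j : g (lie (e i) (e (s j))) u * g (lie (e j) (e (s i))) v = 0.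
  apply/eqP/negPn/negP; rewrite mulf_eq0 negb_or => /andP[/br_arrow ij].
  rewrite lieC linearNl oppr_eq0 => /br_arrow.
  by move=> sij; case: (s_out _ _ ij); rewrite sK.
have := pairing_koszul e sK c0 cs D_lc x y; rewrite {2 3}/pairing.
rewrite [X in _ = X + _]big1 => [|i _]; last first.
  (* Of the four products, the one of two ad's and the one of two adjoints vanish by nilpotency, the
     two mixed ones by condition (1). *)
  rewrite big1 // => j _; rewrite mulrDl !mulrDr ad_nil.
  have := ad_break y x i j; rewrite sK => ->.
  have := ad_break x y j i; rewrite sK mulrC => ->.
  have := ad_nil y x (s j) (s i); rewrite !sK => ->.
  by rewrite !addr0 mul0r.
rewrite big1 => [|i _]; last by rewrite big1 // => j _; rewrite br_break mul0r.
rewrite addr0 (ricci_pairing e_span sK c0 gE cs D_lc) // => /eqP.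
by rewrite mulrn_eq0 => /eqP ->; rewrite oppr0.
Qed.

(** * Parity and size of row and column indices under sigma *)

(* The 1-based indices [i] and [j] of a node [eps_i - eps_j]. *)
Definition row_of k (p : node k) : nat := (val p).1.+1.
Definition col_of k (p : node k) : nat := (val p).2.+1.

(** The involution induced by sigma on row indices; beyond the fixed row 1 it pairs 2l with 2l+1. *)
Definition mate (i : nat) : nat :=
  if i == 1%N then 1%N else if ~~ odd i then i.+1 else i.-1.

Lemma odd_hidx i : odd (hidx i) = false.
Proof. by rewrite /hidx; case: ifP => /= ->. Qed.

Lemma lt_hidx i : (i < hidx i)%N.
Proof. by rewrite /hidx; case: ifP => _. Qed.

Lemma hidx_inj_lt i j : (hidx i <= j)%N -> (hidx i < hidx j)%N.
Proof. by move=> /leq_ltn_trans; apply; apply: lt_hidx. Qed.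

(** [hidx i] is the least even integer exceeding [i], hence common to 2l and 2l+1. *)
Lemma hidx_mate i : (0 < i)%N -> hidx (mate i) = hidx i.
Proof.
case: i => [//|[//|i]] _; rewrite /mate /hidx /=.
by case oi: (odd i); rewrite /= oi.
Qed.

Lemma mateK i : (0 < i)%N -> mate (mate i) = i.
Proof.
case: i => [//|[//|i]] _; rewrite /mate /=.
by case oi: (odd i); rewrite /= ?oi //; case: i oi => //= i ->.
Qed.

Lemma mate_bounds i : (0 < i)%N -> (0 < mate i <= i.+1)%N.
Proof. by case: i => [//|[//|i]] _; rewrite /mate /=; case: ifP => _; lia. Qed.

Lemma odd_mate i : (1 < i)%N -> odd (mate i) = ~~ odd i.
Proof. by case: i => [//|[//|i]] _; rewrite /mate /=; case oi: (odd i); rewrite /= ?oi. Qed.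

Lemma odd_sidx k i j : (j <= (rk k).+1)%N -> odd (sidx (rk k) i j) = odd j.
Proof.
move=> le_j; rewrite /sidx oddB; last by rewrite (leq_trans le_j) ?leq_addr.
by rewrite oddD odd_hidx /rk /= mul2n odd_double.
Qed.

(** * Brackets of root vectors and the arrow-breaking property *)

Section Nodes.
Variable k : nat.
Implicit Types p q r : node k.

Lemma row_gt0 p : (0 < row_of p)%N. Proof. by []. Qed.

Lemma node_bounds p : (hidx (row_of p) <= col_of p <= (rk k).+1)%N.
Proof. by have := valP p; rewrite nodeE. Qed.

Lemma node_eq p q : row_of p = row_of q -> col_of p = col_of q -> p = q.
Proof.
rewrite /row_of /col_of => -[eq1] [eq2]; apply: val_inj.
by rewrite [val p]surjective_pairing [val q]surjective_pairing; congr (_, _); apply: val_inj.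
Qed.

Lemma node_mk i j : (0 < i)%N -> (hidx i <= j <= (rk k).+1)%N ->
  exists p, row_of p = i /\ col_of p = j.
Proof.
by move=> i0 ij; have [pn pi pj] := node_rootD i0 ij;
   exists (exist (fun z => z \in nilroots k) _ pn).
Qed.

Lemma row_col_sigma p :
  row_of (sigma k p) = mate (row_of p) /\ col_of (sigma k p) = sidx (rk k) (row_of p) (col_of p).
Proof.
have i0 := row_gt0 p; have ij := node_bounds p.
rewrite {1}/row_of {1}/col_of sigmaE -{1 2}(rootDK (val p)) -/(row_of p) -/(col_of p).
rewrite sigma_root_rootD //.
have -> : (if row_of p == 1%N then rootD (rk k) 1 (sidx (rk k) (row_of p) (col_of p))
           else if ~~ odd (row_of p) then rootD (rk k) (row_of p).+1 (sidx (rk k) (row_of p) (col_of p))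
           else rootD (rk k) (row_of p).-1 (sidx (rk k) (row_of p) (col_of p))) =
    rootD (rk k) (mate (row_of p)) (sidx (rk k) (row_of p) (col_of p)).
  by rewrite /mate; case: ifP => // _; case: ifP.
have mij : Ind (rk k) (mate (row_of p)) (sidx (rk k) (row_of p) (col_of p)).
  by rewrite /Ind hidx_mate // /sidx; lia.
by have [_ -> ->] := node_rootD (andP (mate_bounds i0)).1 mij.
Qed.

Lemma row_sigma p : row_of (sigma k p) = mate (row_of p).
Proof. by case: (row_col_sigma p). Qed.

Lemma col_sigma p : col_of (sigma k p) = sidx (rk k) (row_of p) (col_of p).
Proof. by case: (row_col_sigma p). Qed.

Lemma sigmaK : involutive (sigma k).
Proof. by move=> p; rewrite !permE sigma_funK. Qed.

Variable R : realType.
Local Notation x := (xvec R k).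

Lemma lie_xvecE p q : col_of p = row_of q ->
  exists r, [/\ row_of r = row_of p, col_of r = col_of q & lie (x p) (x q) = x r].
Proof.
move=> pq; have [|r [rE cE]] := @node_mk (row_of p) (col_of q) (row_gt0 p).
  have := node_bounds p; have := node_bounds q; have := lt_hidx (row_of q); lia.
exists r; split=> //; apply: subvs_inj; rewrite lie_n_Theta /= /root_vector.
have qp : col_of q <> row_of p.
  by have := lt_hidx (row_of p); have := lt_hidx (row_of q); have := node_bounds p; have := node_bounds q; lia.
move: pq qp rE cE; rewrite /row_of /col_of => -[/val_inj ->] qp [/val_inj ->] [/val_inj ->].
by rewrite mul_delta_mx mul_delta_mx_0 ?subr0 //; apply/eqP => e; apply: qp; rewrite e.
Qed.

Lemma lie_xvec0 p q : col_of p <> row_of q -> col_of q <> row_of p -> lie (x p) (x q) = 0.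
Proof.
move=> pq qp; apply: subvs_inj; rewrite lie_n_Theta linear0 /= /root_vector.
by rewrite !mul_delta_mx_0 ?subrr //; apply/eqP => e; [apply: qp | apply: pq];
   rewrite /row_of /col_of e.
Qed.

Lemma xvec_inj p q (a : R) : a != 0 -> x p = a *: x q -> p = q.
Proof.
move=> a0 /(congr1 vsval)/matrixP/(_ (val p).1 (val p).2).
rewrite linearZ /= /root_vector !mxE !eqxx /= => /esym.
case: eqP => [e1|_]; last by move/eqP; rewrite mulr0 eq_sym oner_eq0.
case: eqP => [e2|_]; last by move/eqP; rewrite mulr0 eq_sym oner_eq0.
by move=> _; apply: node_eq; rewrite /row_of /col_of ?e1 ?e2.
Qed.

Lemma xvec_neq0 p : x p != 0.
Proof.
apply/eqP => /(congr1 vsval)/matrixP/(_ (val p).1 (val p).2).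
by rewrite linear0 /= /root_vector !mxE !eqxx => /eqP; rewrite oner_eq0.
Qed.

Lemma arrow_xvec p q r : arrow x p q r ->
  [/\ col_of p = row_of q, row_of r = row_of p & col_of r = col_of q] \/
  [/\ col_of q = row_of p, row_of r = row_of q & col_of r = col_of p].
Proof.
case=> a a0.
have [pq|pq] := eqVneq (col_of p) (row_of q).
  have [r' [rE cE ->]] := lie_xvecE pq => /xvec_inj r'r.
  by left; rewrite -r'r.
have [qp|qp] := eqVneq (col_of q) (row_of p).
  have [r' [rE cE lieE]] := lie_xvecE qp; rewrite lieC lieE => /(canRL (@opprK _)).
  rewrite -scaleNr => /xvec_inj; rewrite oppr_eq0 => /(_ a0) r'r.
  by right; rewrite -r'r.
rewrite lie_xvec0; [|exact/eqP|exact/eqP] => /esym/eqP.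
by rewrite scaler_eq0 (negPf a0) (negPf (xvec_neq0 r)).
Qed.

Lemma xvec_nice p q : lie (x p) (x q) = 0 \/ exists r, arrow x p q r.
Proof.
have [pq|pq] := eqVneq (col_of p) (row_of q).
  have [r [_ _ rE]] := lie_xvecE pq; right; exists r; exists 1; first exact: oner_neq0.
  by rewrite scale1r.
have [qp|qp] := eqVneq (col_of q) (row_of p).
  have [r [_ _ rE]] := lie_xvecE qp; right; exists r; exists (-1).
    by rewrite oppr_eq0 oner_eq0.
  by rewrite lieC rE scaleN1r.
by left; apply: lie_xvec0; apply/eqP.
Qed.

(** Column minus row is the height of a positive root, which is additive under the bracket. *)
Lemma arrow_xvec_height p q r :
  arrow x p q r -> (col_of q - row_of q < col_of r - row_of r)%N.
Proof.
have := node_bounds p; have := node_bounds q.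
have := lt_hidx (row_of p); have := lt_hidx (row_of q).
by move=> h1 h2 h3 h4 /arrow_xvec[[? -> ->]|[? -> ->]]; lia.
Qed.

(* [sidx] preserves the parity of the column index since [hidx] is even, whereas
   [mate] reverses the parity of a row index greater than 1. *)
Lemma sigma_not_composable p q :
  col_of p = row_of q -> col_of (sigma k p) <> row_of (sigma k q).
Proof.
move=> pq eq_s; have := node_bounds p; have := lt_hidx (row_of p).
have := row_gt0 p => h1 h2 h3.
move: (congr1 odd eq_s); rewrite col_sigma row_sigma odd_sidx; last by lia.
by rewrite odd_mate -?pq; [case: (odd _) | lia].
Qed.

(** Size decides here, not parity: the column of [sigma k q] is at least [hidx (row_of q)], so it
    exceeds [col_of p], which exceeds [row_of p], while [mate] raises a row by at most 1. *)
Lemma sigma_not_composable_rev p q :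
  col_of p = row_of q -> col_of (sigma k q) <> row_of (sigma k p).
Proof.
have := node_bounds p; have := lt_hidx (row_of p).
have := node_bounds (sigma k q); rewrite !row_sigma hidx_mate //.
have := lt_hidx (row_of q); have := mate_bounds (row_gt0 p).
lia.
Qed.

Lemma arrow_breaking_sigma : (0 < k)%N -> arrow_breaking x (sigma k).
Proof.
move=> k0; split.
- apply/nt_prime_order => //.
    by apply/permP => p; rewrite expgS expg1 permM perm1 !permE sigma_funK.
  (* Sigma moves E_(1,2) to E_(1,n+1), and n+1 > 2 because k > 0. *)
  have [|p [pi pj]] := @node_mk 1 2 isT; first by rewrite /rk /hidx /=; lia.
  apply/eqP => /permP/(_ p)/(congr1 (@col_of k)); rewrite perm1 col_sigma pi pj.
  by rewrite /sidx /hidx /rk /=; lia.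
(* If [q] labels an arrow into [p], either they share a column and [hidx] is smaller at the row of
   [p], and then sigma puts them in different rows and columns; or they share a row with
   [col_of q < col_of p], and sigma reverses this order. *)
- move=> p q [w /arrow_xvec wqp] [w' /arrow_xvec].
  have [hp hq hw hw'] := And4 (node_bounds p) (node_bounds q) (node_bounds w) (node_bounds w').
  have [lp lw lw'] := And3 (lt_hidx (row_of p)) (lt_hidx (row_of w)) (lt_hidx (row_of w')).
  rewrite !row_sigma !col_sigma /sidx.
  case: wqp => [] [].
    move=> wq pw pq; have pq_lt : (hidx (row_of p) < hidx (row_of q))%N.
      by rewrite pw -wq hidx_inj_lt //; lia.
    case=> [] [_ mm cc]; first by lia.
    by have := congr1 mate mm; rewrite !mateK //; lia.
  by move=> qw pq pw [] []; rewrite pq => ? ? ?; lia.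
(* Composability in the same order before and after sigma is excluded by parity, in opposite orders
   by size. *)
- move=> p q [r /arrow_xvec pqr] [r' /arrow_xvec].
  case: pqr => -[pq _ _] [[pq' _ _]|[pq' _ _]].
  + exact: sigma_not_composable pq pq'.
  + exact: sigma_not_composable_rev pq pq'.
  + exact: sigma_not_composable_rev pq pq'.
  + exact: sigma_not_composable pq pq'.
Qed.
End Nodes.

(** * A nonzero curvature component *)

Section NotFlat.
Variables (R : realType) (k : nat).
Local Notation x := (xvec R k).
Variables (g : metric (n_Theta R k)) (c : node k -> R).
Hypothesis c_neq0 : forall p, c p != 0.
Hypothesis e_span : <<codom x>>%VS = fullv.
Hypothesis gE : forall p q, g (x p) (x (sigma k q)) = c p * (p == q)%:R.
Implicit Types p q r : node k.

Lemma form_xvec p q : g (x p) (x q) = c p * (p == sigma k q)%:R.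
Proof. by rewrite -gE sigmaK. Qed.

Lemma form_lieE p q t :
  col_of p = row_of q -> row_of p = row_of (sigma k t) -> col_of q = col_of (sigma k t) ->
  g (lie (x p) (x q)) (x t) = c (sigma k t).
Proof.
move=> pq pt qt; have [r [rp rq ->]] := lie_xvecE R pq.
have -> : r = sigma k t by apply: node_eq; rewrite ?rp ?rq.
by rewrite form_xvec eqxx mulr1.
Qed.

Lemma form_lie0 p q t :
  ~ (col_of p = row_of q /\ row_of p = row_of (sigma k t) /\ col_of q = col_of (sigma k t)) ->
  ~ (col_of q = row_of p /\ row_of q = row_of (sigma k t) /\ col_of p = col_of (sigma k t)) ->
  g (lie (x p) (x q)) (x t) = 0.
Proof.
move=> npq nqp.
have [pq|pq] := eqVneq (col_of p) (row_of q).
  have [r [rp rq ->]] := lie_xvecE R pq; rewrite form_xvec; have [rt|] := eqVneq r (sigma k t).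
    by case: npq; rewrite -rt.
  by rewrite mulr0.
have [qp|qp] := eqVneq (col_of q) (row_of p).
  have [r [rp rq rE]] := lie_xvecE R qp; rewrite lieC rE linearNl /= form_xvec.
  have [rt|] := eqVneq r (sigma k t); last by rewrite mulr0 oppr0.
  by case: nqp; rewrite -rt.
by rewrite lie_xvec0 ?linear0l //; apply/eqP.
Qed.

Lemma not_flat_sigma : (0 < k)%N -> ~ flat g.
Proof.
(* This [n] is the matrix size N. When k = 1 the nodes [r], [w] and [y] below coincide. *)
move=> k0 flat_g; set n := (2 * k).+2; have n4 : (4 <= n)%N by rewrite /n; lia.
have hn : hidx n.-1 = n by rewrite /hidx /n /= mul2n odd_double.
have mn : mate n.-1 = n.-2 by rewrite /mate /n /= mul2n odd_double /=; case: eqP; lia.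
have mk i j : (0 < i)%N -> (hidx i <= j <= n)%N -> exists p, row_of p = i /\ col_of p = j.
  exact: node_mk.
have [|u [u1 u2]] := mk 1%N 2%N isT; first by rewrite /hidx /=; lia.
have [|p [p1 p2]] := mk 1%N 3%N isT; first by rewrite /hidx /=; lia.
have [|r [r1 r2]] := mk 3%N 4%N isT; first by rewrite /hidx /=; lia.
have [|w [w1 w2]] := mk 3%N n isT; first by rewrite /hidx /=; lia.
have [||y [y1 y2]] := mk n.-1 n; [by lia | by rewrite hn; lia |].
have su1 : row_of (sigma k u) = 1%N by rewrite row_sigma u1.
have su2 : col_of (sigma k u) = n by rewrite col_sigma u1 u2 /sidx /hidx /rk /=; lia.
have sw1 : row_of (sigma k w) = 2%N by rewrite row_sigma w1.
have sr1 : row_of (sigma k r) = 2%N by rewrite row_sigma r1.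
have sr2 : col_of (sigma k r) = n by rewrite col_sigma r1 r2 /sidx /hidx /rk /=; lia.
have sp1 : row_of (sigma k p) = 1%N by rewrite row_sigma p1.
have sp2 : col_of (sigma k p) = n.-1 by rewrite col_sigma p1 p2 /sidx /hidx /rk /=; lia.
have sy1 : row_of (sigma k y) = n.-2 by rewrite row_sigma y1.
have sy2 : col_of (sigma k y) = n by rewrite col_sigma y1 y2 /sidx hn addnK.
have D_lc := lc_connectionP g; set D := lc_connection g in D_lc.
have kos := levi_civita_koszul D_lc.
have line v q : (forall t, t <> sigma k q -> g v (x t) = 0) ->
    v = (g v (x (sigma k q)) / c q) *: x q.
  move=> vq; apply: (sigma_diagonal_line e_span c_neq0 gE) => i /eqP iq; apply: vq.
  by move=> /perm_inj.
(* In the Koszul formula [t] contributes only if [u, t] is a multiple of sigma(u) = E_(1,N), that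
   is, for t = E_(2,N) = sigma(r). *)
have uu : D (x u) (x u) = (g (D (x u) (x u)) (x (sigma k r)) / c r) *: x r.
  apply: line => t tr; apply: double_eq0; rewrite -mulr2n kos.
  have {}tr : ~ (row_of t = 2%N /\ col_of t = n).
    by move=> [t1 t2]; apply: tr; apply: node_eq; lia.
  have := node_bounds t; have := lt_hidx (row_of t) => t1 t2.
  rewrite lie_alt linear0l [g (lie (x u) (x t)) _]form_lie0; [|lia..].
  by rewrite form_lie0 ?subr0 ?addr0 //; lia.
have [u_y y_u] : col_of u <> row_of y /\ col_of y <> row_of u by lia.
(* Only the term [t, y] can contribute, and it meets sigma(u) = E_(1,N) just for t = E_(1,N-1) =
   sigma(p). *)
have yu : D (x y) (x u) = (g (D (x y) (x u)) (x (sigma k p)) / c p) *: x p.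
  apply: line => t tp; apply: double_eq0; rewrite -mulr2n kos.
  have {}tp : ~ (row_of t = 1%N /\ col_of t = n.-1).
    by move=> [t1 t2]; apply: tp; apply: node_eq; lia.
  have := node_bounds t; have := lt_hidx (row_of t) => t1 t2.
  rewrite lie_xvec0 // linear0l [g (lie (x u) (x t)) _]form_lie0; [|lia..].
  by rewrite form_lie0 ?subr0 ?addr0 //; lia.
have yu_p : g (D (x y) (x u)) (x (sigma k p)) *+ 2 = c (sigma k u).
  rewrite kos lie_xvec0 // linear0l [g (lie (x u) _) _]form_lie0; [|lia..].
  by rewrite form_lieE ?subr0 ?add0r //; lia.
have up_w : g (D (x u) (x p)) (x w) *+ 2 = - c (sigma k u).
  rewrite kos [g (lie (x u) _) _]form_lie0; [|lia..].
  rewrite [g (lie (x p) _) _]form_lieE; [|lia..].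
  by rewrite form_lie0 ?addr0 ?sub0r //; lia.
have yr_w : g (D (x y) (x r)) (x w) = 0.
  apply: double_eq0; rewrite -mulr2n kos.
  rewrite [g (lie (x y) _) _]form_lie0; [|lia..].
  rewrite [g (lie (x r) _) _]form_lie0; [|lia..].
  by rewrite form_lie0 ?addr0 ?subr0 //; lia.
have := flat_g (x u) (x y); rewrite -/D => /lfunP/(_ (x u)).
rewrite /curvature !add_lfunE !opp_lfunE !comp_lfunE zero_lfunE.
rewrite lie_xvec0 // linear0 zero_lfunE subr0 yu uu !linearZ /=.
move=> /(congr1 (fun v => g v (x w))) /=.
rewrite linearDl !linearZl_LR linearNl /= yr_w oppr0 mulr0 addr0 linear0l => /eqP.
(* Flatness has become the vanishing of a product whose factors are, up to sign and the nonzero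
   [c p], both half of [c (sigma k u)]. *)
rewrite !mulf_eq0 invr_eq0 (negPf (c_neq0 p)) orbF => /orP[] /eqP e0.
  by move: yu_p; rewrite e0 mul0rn => /esym/eqP; rewrite (negPf (c_neq0 _)).
by move: up_w; rewrite e0 mul0rn => /esym/eqP; rewrite oppr_eq0 (negPf (c_neq0 _)).
Qed.
End NotFlat.

Theorem proposition4p4 (R : realType) (k : nat) (hk : (1 <= k)%N) :
  arrow_breaking (xvec R k) (sigma k) /\
  (forall g : metric (n_Theta R k),
     sigma_diagonal (xvec R k) (sigma k) g -> ricci_flat g) /\
  (forall g : metric (n_Theta R k),
     sigma_diagonal (xvec R k) (sigma k) g -> ~ flat g).
Proof.
have e_span : <<codom (xvec R k)>>%VS = fullv by case/andP: (xvec_basis R k) => /eqP.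
have breaking := arrow_breaking_sigma R hk.
split=> //; split=> g => [|[c [c0 _ gE]]]; last exact: not_flat_sigma c0 e_span gE hk.
apply: ricci_flat_arrow_breaking breaking => //; first exact: xvec_nice.
exact: arrow_xvec_height.
Qed.
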